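(* Let $\mathcal{A}$ be a real symmetric tensor of order $m$ and dimension $n$. Then $\mathcal{A}$ is copositive if and only if every principal sub-tensor of $\mathcal{A}$ has no negative $H^{++}$-eigenvalue, i.e., no principal sub-tensor of $\mathcal{A}$ has an eigenvector $v>0$ with associated $H$-eigenvalue $\lambda<0$.
   Context: Let $m,n$ be positive integers. A real tensor of order $m$ and dimension $n$ is an array $\mathcal{A}=(a_{i_1\cdots i_m})$ with $a_{i_1\cdots i_m}\in\mathbb{R}$, $1\le i_1,\dots,i_m\le n$. It is symmetric if its entries are invariant under every permutation of the indices. For $x\in\mathbb{R}^n$, $\mathcal{A}x^{m-1}\in\mathbb{R}^n$ is the vector with $i$-th component $\sum_{i_2,\dots,i_m=1}^n a_{ii_2\cdots i_m}x_{i_2}\cdots x_{i_m}$, and $\mathcal{A}x^m=x^T(\mathcal{A}x^{m-1})=\sum_{i_1,\dots,i_m=1}^n a_{i_1\cdots i_m}x_{i_1}\cdots x_{i_m}$. For a real vector $x$, $x\ge 0$ (resp. $x>0$) means all components are $\ge 0$ (resp. $>0$); $\mathbb{R}^n_+=\{x\in\mathbb{R}^n: x\ge 0\}$ and $\mathbb{R}^n_{++}=\{x\in\mathbb{R}^n: x>0\}$. $\mathcal{A}$ is copositive if $\mathcal{A}x^m\ge 0$ for all $x\in\mathbb{R}^n_+$. For $1\le r\le n$ and a set $\mathcal{N}\subseteq\{1,\dots,n\}$ with $r$ elements, the array $\mathcal{B}=(a_{i_1\cdots i_m})_{i_1,\dots,i_m\in\mathcal{N}}$ is an order $m$, dimension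 $r$ principal sub-tensor of $\mathcal{A}$ (the case $\mathcal{N}=\{1,\dots,n\}$, giving $\mathcal{A}$ itself, is included). For a tensor $\mathcal{B}$ of order $m$ and dimension $r$, a real number $\lambda$ is an $H$-eigenvalue with $H$-eigenvector $x\in\mathbb{R}^r\setminus\{0\}$ if $\mathcal{B}x^{m-1}=\lambda x^{[m-1]}$, where $x^{[m-1]}=(x_1^{m-1},\dots,x_r^{m-1})^T$. It is an $H^{++}$-eigenvalue of $\mathcal{B}$ if it has an $H$-eigenvector in $\mathbb{R}^r_{++}$. *)

(* Defs.v *)
From mathcomp Require Import all_boot all_order all_algebra all_fingroup.
From mathcomp Require Import reals.

Set Implicit Arguments.
Unset Strict Implicit.
Unset Printing Implicit Defensive.

Import Order.TTheory GRing.Theory Num.Theory.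
Local Open Scope ring_scope.

(* The entry a_{i_1 ... i_m} is [A [tuple i_1; ...; i_m]], with indices
   counted from 0. *)
Definition tensor (R : realType) (m n : nat) := {ffun m.-tuple 'I_n -> R}.

Definition symmetric_tensor (R : realType) (m n : nat) (A : tensor R m n) : Prop :=
  forall (s : 'S_m) (t : m.-tuple 'I_n), A [tuple tnth t (s k) | k < m] = A t.

Definition nonneg_vec (R : realType) (n : nat) (x : 'cV[R]_n) : Prop :=
  forall i, 0 <= x i 0.

Definition pos_vec (R : realType) (n : nat) (x : 'cV[R]_n) : Prop :=
  forall i, 0 < x i 0.

(* A x^m *)
Definition tensor_form (R : realType) (m n : nat) (A : tensor R m n)
    (x : 'cV[R]_n) : R :=
  \sum_(t : m.-tuple 'I_n) A t * \prod_(k < m) x (tnth t k) 0.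

(* For A of order m.+1 this is A x^m, i.e. "A x^(order - 1)"; the first index
   stays free. *)
Definition tensor_apply (R : realType) (m n : nat) (A : tensor R m.+1 n)
    (x : 'cV[R]_n) : 'cV[R]_n :=
  \col_i \sum_(t : m.-tuple 'I_n) A [tuple of i :: t] * \prod_(k < m) x (tnth t k) 0.

(* x^[k] *)
Definition vec_pow (R : realType) (n : nat) (x : 'cV[R]_n) (k : nat) : 'cV[R]_n :=
  \col_i x i 0 ^+ k.

Definition copositive (R : realType) (m n : nat) (A : tensor R m n) : Prop :=
  forall x : 'cV[R]_n, nonneg_vec x -> 0 <= tensor_form A x.

(* [enum_val : 'I_#|N| -> 'I_n] lists N in increasing order. *)
Definition principal_subtensor (R : realType) (m n : nat) (A : tensor R m n)
    (N : {set 'I_n}) : tensor R m #|N| :=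
  [ffun t : m.-tuple 'I_#|N| => A [tuple of map (@enum_val _ (mem N)) t]].

Definition H_eigenvector (R : realType) (m r : nat) (B : tensor R m.+1 r)
    (lambda : R) (x : 'cV[R]_r) : Prop :=
  x != 0 /\ tensor_apply B x = lambda *: vec_pow x m.

Definition Hpp_eigenvalue (R : realType) (m r : nat) (B : tensor R m.+1 r)
    (lambda : R) : Prop :=
  exists2 v : 'cV[R]_r, pos_vec v & H_eigenvector B lambda v.

(* Main.v *)
(* If A is not copositive, let lambda < 0 be the minimum of A x^m on the compact
   set of x >= 0 with sum_i x_i^m = 1, attained at x. By homogeneity,
   g(z) = A z^m - lambda * sum_i z_i^m is nonnegative on the whole orthant and
   vanishes at x, so its partial derivatives in the directions of the support N
   of x are zero. By symmetry these are m ((A x^(m-1))_i - lambda x_i^(m-1)),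
   hence x restricted to N is a positive eigenvector of the subtensor on N for
   the eigenvalue lambda. Conversely, extending such an eigenvector by zero
   makes A x^m negative. *)
From mathcomp Require Import boolp classical_sets topology normedtype derive realfun exp.
Require Import Defs.
From mathcomp Require Import all_boot all_order all_algebra all_fingroup.
From mathcomp Require Import reals.

Import Order.TTheory GRing.Theory Num.Theory.
Import numFieldNormedType.Exports.
Local Open Scope ring_scope.

Set Implicit Arguments.
Unset Strict Implicit.
Unset Printing Implicit Defensive.

(** * Derivatives of polynomials *)

Lemma deriv_prod_seq (R : comNzRingType) (I : eqType) (r : seq I)
    (F : I -> {poly R}) : uniq r ->
  (\prod_(i <- r) F i)^`() =
  \sum_(i <- r) (F i)^`() * \prod_(j <- r | j != i) F j.
Proof.
elim: r => [|x r IHr] /=; first by rewrite !big_nil derivC.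
case/andP=> xr /IHr {}IHr; rewrite !big_cons derivM IHr eqxx /=; congr (_ + _).
  congr (_ * _); rewrite [RHS]big_seq_cond [LHS]big_seq; apply: eq_bigl => j.
  by case: (boolP (j \in r)) => //= jr; apply/esym/(memPn xr).
rewrite big_distrr /= !big_seq; apply: eq_bigr => i ir; rewrite big_cons.
have -> : x != i by rewrite eq_sym; exact: (memPn xr).
by rewrite mulrCA.
Qed.

(** Fermat's rule at an interior minimum, put in terms of the formal derivative so that partial
    derivatives can later be computed algebraically. *)
Lemma deriv_poly_local_min (R : realType) (p : {poly R}) (d : R) : 0 < d ->
  (forall h, `|h| < d -> p.[0] <= p.[h]) -> p^`().[0] = 0.
Proof.
move=> d0 pmin; rewrite derive.derivE derive1E.
have ab : - d <= d by rewrite ge0_cp // ltW.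
have min0 : is_derive (0 : R) 1 (horner p) 0.
  apply: (@derive1_at_min R (horner p) (- d) d 0 ab).
  - by move=> t _; apply: derivable_horner.
  - by rewrite in_itv /= oppr_lt0 d0.
  - by move=> t; rewrite in_itv /= -ltr_norml => /pmin.
exact: (@derive_val _ _ _ _ _ _ _ min0).
Qed.

(** * Tensor forms and their restriction to principal subtensors *)

Lemma sum_tuple_recl (R : nmodType) (T : finType) (m : nat)
    (F : m.+1.-tuple T -> R) :
  \sum_t F t = \sum_i \sum_(t : m.-tuple T) F [tuple of i :: t].
Proof.
rewrite pair_big /=.
rewrite (reindex (fun p : T * m.-tuple T => [tuple of p.1 :: p.2])) //=.
exists (fun t => (thead t, behead_tuple t)) => [[i t] _ | t _] /=.
  by congr (_, _); apply: val_inj.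
by rewrite [RHS]tuple_eta; apply: val_inj.
Qed.

Lemma tensor_formE (R : realType) (m n : nat) (A : tensor R m.+1 n)
    (x : 'cV[R]_n) :
  tensor_form A x = \sum_i x i 0 * tensor_apply A x i 0.
Proof.
rewrite /tensor_form sum_tuple_recl; apply: eq_bigr => i _.
rewrite mxE big_distrr /=; apply: eq_bigr => t _.
rewrite big_ord_recl mulrCA; congr (_ * (_ * _)).
by apply: eq_bigr => k _; rewrite tnthS.
Qed.

Lemma tensor_formZ (R : realType) (m n : nat) (A : tensor R m n) (c : R)
    (x : 'cV[R]_n) :
  tensor_form A (c *: x) = c ^+ m * tensor_form A x.
Proof.
rewrite /tensor_form big_distrr /=; apply: eq_bigr => t _.
under eq_bigr do rewrite mxE.
by rewrite big_split /= prodr_const card_ord mulrCA.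
Qed.

(** An index tuple that leaves [N] contributes a zero factor of [x]; the remaining tuples are
    exactly the images under [enum_val] of the tuples over ['I_#|N|]. *)
Lemma tensor_apply_sub (R : realType) (m n : nat) (A : tensor R m.+1 n)
    (N : {set 'I_n}) (x : 'cV[R]_n) (v : 'cV[R]_#|N|) (k : 'I_#|N|) :
  (forall i, i \notin N -> x i 0 = 0) ->
  (forall l : 'I_#|N|, v l 0 = x (enum_val l) 0) ->
  tensor_apply (principal_subtensor A N) v k 0 =
  tensor_apply A x (enum_val k) 0.
Proof.
move=> xN vx; rewrite !mxE.
pose inj (t : m.-tuple 'I_#|N|) := [tuple of map (@enum_val _ (mem N)) t].
pose supp (t : m.-tuple 'I_n) := all [in N] t.
rewrite [RHS](bigID supp) /= [X in _ + X]big1 ?addr0; last first.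
  move=> t /allPn[i /tnthP[l ->] lN].
  by rewrite (bigD1 l) //= xN // mul0r mulr0.
(* The default [k] is arbitrary: it is never reached on tuples with all entries in [N]. *)
pose inv (t : m.-tuple 'I_n) :=
  [tuple of map (fun i => odflt k (insub (index i (enum N)))) t].
rewrite (reindex_onto inj inv) /=; last first.
  move=> t /allP tN; apply: eq_from_tnth => l; rewrite !tnth_map.
  have lN : tnth t l \in N by apply: tN; apply: mem_tnth.
  have lt : (index (tnth t l) (enum N) < #|N|)%N.
    by rewrite cardE index_mem mem_enum.
  by rewrite insubT /= (enum_val_nth (tnth t l)) /= nth_index // mem_enum.
apply: eq_big => [t | t _].
  apply/esym/andP; split.
    by apply/allP => i /mapP[l _ ->]; apply: enum_valP.
  apply/eqP/eq_from_tnth => l; rewrite !tnth_map.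
  rewrite (enum_val_nth (enum_val (tnth t l))) index_uniq ?enum_uniq -?cardE //.
  by rewrite valK.
rewrite ffunE; congr (A _ * _); first by apply: val_inj.
by apply: eq_bigr => l _; rewrite vx tnth_map.
Qed.

Lemma principal_eigen_form (R : realType) (m n : nat) (A : tensor R m.+1 n)
    (N : {set 'I_n}) (x : 'cV[R]_n) (v : 'cV[R]_#|N|) (lambda : R) :
  (forall i, i \notin N -> x i 0 = 0) ->
  (forall l : 'I_#|N|, v l 0 = x (enum_val l) 0) ->
  tensor_apply (principal_subtensor A N) v = lambda *: vec_pow v m ->
  tensor_form A x = lambda * \sum_k v k 0 ^+ m.+1.
Proof.
move=> xN vx Bv; rewrite tensor_formE (bigID [in N]) /= [X in _ + X]big1 ?addr0.
  rewrite big_enum_val /= big_distrr; apply: eq_bigr => k _ /=.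
  by rewrite -(tensor_apply_sub _ _ xN vx) Bv !mxE -vx exprS mulrCA.
by move=> i iN; rewrite xN ?mul0r.
Qed.

(** * Partial derivatives of the form *)

(** The line x + h e_i, coordinate by coordinate, with ['X] in the role of h. Along it the form
    becomes a univariate polynomial. *)
Definition perturb_poly (R : realType) (n : nat) (x : 'cV[R]_n) (i j : 'I_n) :
  {poly R} := (x j 0)%:P + (j == i)%:R *: 'X.

Definition tensor_poly (R : realType) (m n : nat) (A : tensor R m n)
    (x : 'cV[R]_n) (i : 'I_n) : {poly R} :=
  \sum_(t : m.-tuple 'I_n) A t *: \prod_(k < m) perturb_poly x i (tnth t k).

Lemma horner_perturb_poly (R : realType) (n : nat) (x : 'cV[R]_n)
    (i j : 'I_n) (h : R) :
  (perturb_poly x i j).[h] = (x + h *: delta_mx i 0) j 0.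
Proof. by rewrite !hornerE !mxE eqxx andbT mulrC. Qed.

Lemma horner_tensor_poly (R : realType) (m n : nat) (A : tensor R m n)
    (x : 'cV[R]_n) (i : 'I_n) (h : R) :
  (tensor_poly A x i).[h] = tensor_form A (x + h *: delta_mx i 0).
Proof.
rewrite /tensor_poly horner_sum; apply: eq_bigr => t _.
rewrite hornerZ horner_prod; congr (_ * _).
by apply: eq_bigr => k _; apply: horner_perturb_poly.
Qed.

(** The product rule gives one sum for each position of the index i among the m+1 positions. By
    symmetry all these sums equal the one for position 0, which is the i-th component of
    [tensor_apply]. *)
Lemma deriv_tensor_poly (R : realType) (m n : nat) (A : tensor R m.+1 n)
    (x : 'cV[R]_n) (i : 'I_n) : symmetric_tensor A ->
  (tensor_poly A x i)^`().[0] = m.+1%:R * tensor_apply A x i 0.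
Proof.
move=> symA; rewrite /tensor_poly raddf_sum horner_sum.
pose G (k : 'I_m.+1) (t : m.+1.-tuple 'I_n) : R :=
  A t * ((tnth t k == i)%:R * \prod_(j | j != k) x (tnth t j) 0).
transitivity (\sum_t \sum_k G k t).
  apply: eq_bigr => t _; rewrite /= derivZ hornerZ deriv_prod_seq ?index_enum_uniq //.
  rewrite horner_sum big_distrr /=; apply: eq_bigr => k _.
  rewrite /G hornerM horner_prod; congr (_ * (_ * _)).
    by rewrite /perturb_poly !derivE !hornerE.
  by apply: eq_bigr => j _; rewrite horner_perturb_poly scale0r addr0.
(* Exchanging positions [k] and 0 permutes the tuples and, by symmetry, preserves the entries of
   [A]. *)
have swap k : \sum_t G k t = \sum_t G 0 t.
  pose s : 'S_m.+1 := tperm k 0.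
  pose f (t : m.+1.-tuple 'I_n) := [tuple tnth t (s j) | j < m.+1].
  have fK : involutive f.
    by move=> t; apply: eq_from_tnth => j; rewrite !tnth_mktuple tpermK.
  rewrite (reindex_inj (inv_inj fK)); apply: eq_bigr => t _.
  rewrite /G symA tnth_mktuple tpermL; congr (_ * (_ * _)).
  rewrite (reindex_inj (@perm_inj _ s)); apply: eq_big => [j | j _].
    by rewrite -[k in _ != k](tpermR k 0) (inj_eq perm_inj).
  by rewrite tnth_mktuple tpermK.
rewrite exchange_big (eq_bigr _ (fun k _ => swap k)) sumr_const card_ord.
(* Splitting off the first index leaves only the tuples that start with [i]. *)
rewrite -[in LHS]mulr_natl; congr (_ * _); rewrite sum_tuple_recl (bigD1 i) //=.
rewrite [X in _ + X]big1 ?addr0 => [|j ji]; last first.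
  by apply: big1 => t _; rewrite /G tnth0 (negPf ji) mul0r mulr0.
rewrite mxE; apply: eq_bigr => t _; rewrite /G tnth0 eqxx mul1r.
congr (_ * _); rewrite big_mkcond big_ord_recl /= mul1r.
by apply: eq_bigr => j _; rewrite tnthS.
Qed.

(** * Existence of a normalized minimizer *)

Lemma continuous_tensor_form (R : realType) (m n : nat) (A : tensor R m n) :
  continuous (fun x : 'rV[R]_n => tensor_form A x^T).
Proof.
rewrite /tensor_form.
apply: (@continuous_big _ _ _ _ _ (@add_continuous R)) => t _ x.
apply: (@continuousM _ _ (fun=> A t)); first exact: cst_continuous.
move: x; apply: (@continuous_big _ _ _ _ _ (@mul_continuous R)) => k _.
by under eq_fun do rewrite mxE; exact: coord_continuous.
Qed.

Lemma exists_nonneg_root (R : realType) (m : nat) (s : R) : 0 <= s ->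
  exists2 c : R, 0 <= c & c ^+ m.+1 = s.
Proof.
move=> s0; exists (s `^ m.+1%:R^-1); first exact: powR_ge0.
by rewrite -powR_mulrn ?powR_ge0 // -powRrM mulVf ?pnatr_eq0 // powRr1.
Qed.

Lemma sum_powS_gt0 (R : realType) (m n : nat) (x : 'cV[R]_n) :
  nonneg_vec x -> x != 0 -> 0 < \sum_i x i 0 ^+ m.+1.
Proof.
move=> x0 xn0; rewrite lt_def sumr_ge0 ?andbT => [|i _]; last exact: exprn_ge0.
apply: contraNneq xn0 => /psumr_eq0P xi0; apply/eqP/colP => i; rewrite mxE.
have /eqP : x i 0 ^+ m.+1 = 0 by apply: xi0 => // j _; apply: exprn_ge0.
by rewrite expf_eq0 => /eqP.
Qed.

Lemma not_copositive_min (R : realType) (m n : nat) (A : tensor R m.+1 n)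
    (y : 'cV[R]_n) : nonneg_vec y -> tensor_form A y < 0 ->
  exists (lambda : R) (x : 'cV[R]_n),
    [/\ lambda < 0, nonneg_vec x, x != 0,
        tensor_form A x = lambda * \sum_i x i 0 ^+ m.+1
      & forall z, nonneg_vec z ->
          lambda * (\sum_i z i 0 ^+ m.+1) <= tensor_form A z].
Proof.
move=> y0 fy.
pose S : 'rV[R]_n -> R := fun x => \sum_i x 0 i ^+ m.+1.
have contS : continuous S.
  apply: (@continuous_big _ _ _ _ _ (@add_continuous R)) => i _ x.
  apply: (@continuous_comp _ _ _ (fun y : 'rV[R]_n => y 0 i) (fun c => c ^+ m.+1)).
    exact: coord_continuous.
  exact: exprn_continuous.
(* The box makes [K] compact and costs nothing: for nonnegative vectors, S = 1 already forces every
   coordinate to be at most 1. *)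
pose box : set 'rV[R]_n := [set x | forall i, `[0, 1] (x 0 i)]%classic.
pose K : set 'rV[R]_n := (box `&` S @^-1` [set 1])%classic.
have cptK : compact K.
  apply: compact_closedI.
    exact: (@rV_compact R n (fun=> `[0, 1]%classic)
      (fun=> @segment_compact R 0 1)).
  by apply: preimage_closed => [x _|]; [exact: contS | exact: closed_eq].
have ST z : S z^T = \sum_i z i 0 ^+ m.+1.
  by apply: eq_bigr => i _; rewrite mxE.
have fT z : tensor_form A z^T^T = tensor_form A z by rewrite trmxK.
(* Every nonzero nonnegative vector is a positive multiple of a point of [K]; the factor is the
   (m+1)-th root of its value under [S]. *)
have normalize z : nonneg_vec z -> z != 0 ->
    exists c : R, [/\ 0 < c, c ^+ m.+1 = S z^T & K (c^-1 *: z)^T].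
  move=> z0 zn0; have s0 : 0 < S z^T by rewrite ST sum_powS_gt0.
  have [c c0 cE] := exists_nonneg_root m (ltW s0).
  have {}c0 : 0 < c.
    rewrite lt_def c0 andbT; apply: contraTneq s0 => cz.
    by rewrite -cE cz exprS mul0r ltxx.
  exists c; split=> //.
  have Sz : S (c^-1 *: z)^T = 1.
    rewrite ST; under eq_bigr do rewrite mxE exprMn.
    by rewrite -big_distrr /= exprVn cE ST mulVf // -ST gt_eqF.
  have nz i : 0 <= (c^-1 *: z) i 0 by rewrite mxE mulr_ge0 ?invr_ge0 // ltW.
  split=> // i; rewrite /= in_itv /= mxE nz /=.
  rewrite -(@expr_le1 _ m.+1) // -Sz ST (bigD1 i) //= lerDl sumr_ge0 // => j _.
  exact: exprn_ge0.
(* A form of positive order vanishes at 0, by homogeneity with factor 0. *)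
have yn0 : y != 0.
  apply: contraTneq fy => ->; rewrite -(scale0r (0 : 'cV[R]_n)) tensor_formZ.
  by rewrite exprS !mul0r ltxx.
(* The rescaled [y] shows that [K] is nonempty, and below that the minimum is negative. *)
have [cy [cy0 cyE Ky]] := normalize y y0 yn0.
have [x /set_mem[xbox Sx] xmin] := compact_EVT_min (ex_intro _ _ Ky) cptK
  (continuous_subspaceT (@continuous_tensor_form R m.+1 n A)).
have mono z : nonneg_vec z ->
    tensor_form A x^T * (\sum_i z i 0 ^+ m.+1) <= tensor_form A z.
  move=> z0; have [-> | zn0] := eqVneq z 0.
    rewrite -(scale0r (0 : 'cV[R]_n)) tensor_formZ exprS !mul0r big1 ?mulr0 //.
    by move=> i _; rewrite !mxE exprS mul0r mul0r.
  have [c [c0 cE Kz]] := normalize z z0 zn0.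
  have := xmin _ (mem_set Kz); rewrite fT tensor_formZ exprVn mulrC.
  by rewrite ler_pdivlMr ?exprn_gt0 // cE ST.
have sumx : \sum_i x^T i 0 ^+ m.+1 = 1 by rewrite -ST trmxK.
exists (tensor_form A x^T), x^T; split=> //.
- have := xmin _ (mem_set Ky); rewrite fT tensor_formZ => /le_lt_trans; apply.
  by rewrite pmulr_rlt0 // exprn_gt0 // invr_gt0.
- by move=> i; rewrite mxE; have := xbox i; rewrite /= in_itv => /andP[].
- apply/eqP => xz; move/eqP: sumx; rewrite big1 ?(eq_sym 0) ?oner_eq0 // => i _.
  by rewrite xz mxE exprS mul0r.
- by rewrite sumx mulr1.
Qed.

(** * From minimizers to eigenvectors, and the equivalence *)

Lemma minimizer_eigen (R : realType) (m n : nat) (A : tensor R m.+1 n)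
    (lambda : R) (x : 'cV[R]_n) (i : 'I_n) :
  symmetric_tensor A -> nonneg_vec x ->
  tensor_form A x = lambda * (\sum_j x j 0 ^+ m.+1) ->
  (forall z, nonneg_vec z ->
     lambda * (\sum_j z j 0 ^+ m.+1) <= tensor_form A z) ->
  0 < x i 0 -> tensor_apply A x i 0 = lambda * x i 0 ^+ m.
Proof.
move=> symA x0 fx fmin xi0.
pose p := tensor_poly A x i - lambda *: \sum_j perturb_poly x i j ^+ m.+1.
have pE h : p.[h] = tensor_form A (x + h *: delta_mx i 0)
    - lambda * \sum_j (x + h *: delta_mx i 0) j 0 ^+ m.+1.
  rewrite /p hornerD hornerN hornerZ horner_tensor_poly horner_sum.
  congr (_ - _ * _); apply: eq_bigr => j _.
  by rewrite horner_exp horner_perturb_poly.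
have p0 : p.[0] = 0 by rewrite pE scale0r addr0 fx subrr.
have /eqP : p^`().[0] = 0.
  (* The radius is x_i itself: for |h| < x_i the point x + h e_i stays in the orthant, so h = 0 is a
     two-sided minimum. *)
  apply: (deriv_poly_local_min xi0) => h hlt; rewrite p0 pE subr_ge0; apply: fmin.
  move=> j; rewrite !mxE eqxx andbT; have [-> | _] := eqVneq j i.
    rewrite mulr1 addrC -lerBlDr sub0r.
    by case/ltr_normlP: hlt => /ltW; rewrite lerNl.
  by rewrite mulr0 addr0.
rewrite /p derivB hornerD hornerN deriv_tensor_poly //.
(* Only the summand j = i of the power sum depends on h. Its derivative carries the same factor m+1
   as that of the form, and this factor is cancelled at the end. *)
rewrite derivZ hornerZ raddf_sum horner_sum (bigD1 i) //=.
rewrite [X in _ * (_ + X)]big1 ?addr0 => [|j ji]; last first.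
  rewrite deriv_exp /perturb_poly (negPf ji) scale0r addr0 derivC.
  by rewrite mul0r mul0rn horner0.
rewrite deriv_exp /= hornerMn hornerM horner_exp horner_perturb_poly scale0r addr0.
rewrite /perturb_poly eqxx scale1r derivD derivC derivX !hornerE subr_eq0.
rewrite -(mulr_natl (x i 0 ^+ m)) mulrCA => /eqP /mulfI; apply.
by rewrite pnatr_eq0.
Qed.

Unset Implicit Arguments.

(* The order is m.+1, which ranges over all positive integers. *)
Theorem theorem4p1 (R : realType) (m n : nat) (hn : (0 < n)%N)
    (A : tensor R m.+1 n) (hA : symmetric_tensor A) :
  copositive A <->
  (forall N : {set 'I_n}, N != set0 ->
     ~ (exists2 lambda : R,
          lambda < 0 & Hpp_eigenvalue (principal_subtensor A N) lambda)).
Proof.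
split=> [copA N _ [lambda lambda0 [v v0 [vn0 Bv]]] | noneg y y0].
  (* Extension of [v] by zero: since [enum_val] is injective, the sum has exactly one term for [i]
     in [N] and none outside. *)
  pose x : 'cV[R]_n := \col_i \sum_(k | enum_val k == i) v k 0.
  have vx l : v l 0 = x (enum_val l) 0.
    rewrite mxE (bigD1 l) //= big1 ?addr0 // => k /andP[/eqP/enum_val_inj ->].
    by rewrite eqxx.
  have xN i : i \notin N -> x i 0 = 0.
    move=> iN; rewrite mxE big1 // => k /eqP ki.
    by move: iN; rewrite -ki enum_valP.
  have x0 : nonneg_vec x.
    by move=> i; rewrite mxE sumr_ge0 // => k _; apply/ltW/v0.
  have := copA x x0; rewrite (principal_eigen_form xN vx Bv).
  by rewrite leNgt nmulr_rlt0 // sum_powS_gt0 // => k; apply/ltW/v0.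
rewrite leNgt; apply/negP => fy.
have [lambda [x [lambda0 x0 xn0 fx fmin]]] := not_copositive_min y0 fy.
(* Restricting to the support of the minimizer makes all coordinates positive, as both [pos_vec] and
   [minimizer_eigen] require. *)
pose N := [set i | x i 0 != 0].
pose v : 'cV[R]_#|N| := \col_k x (enum_val k) 0.
have vx l : v l 0 = x (enum_val l) 0 by rewrite mxE.
have xN i : i \notin N -> x i 0 = 0 by rewrite inE negbK => /eqP.
have v0 : pos_vec v.
  by move=> k; rewrite vx lt_def x0 andbT; have := enum_valP k; rewrite inE.
have N0 : N != set0.
  apply: contraNneq xn0 => N0; apply/eqP/colP => i.
  by rewrite mxE xN // N0 inE.
apply: (noneg N N0); exists lambda => //; exists v => //; split.
  have [i iN] := set0Pn _ N0; apply: contraTneq (v0 (enum_rank_in iN i)) => ->.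
  by rewrite mxE ltxx.
apply/colP => k; rewrite (tensor_apply_sub _ _ xN vx) [RHS]mxE [vec_pow _ _ _ _]mxE vx.
by apply: minimizer_eigen => //; rewrite -vx.
Qed.
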